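(* Let $G$ be a bipartite graph with vertex bipartition $A\sqcup B$, with $m$ edges and $t$ hexagons ($6$-cycles). Let $L=|A|$, $R=|B|$ with $100\le L\le R$, let $n=L+R$, and let $d_L=m/L$, $d_R=m/R$. Suppose \[ \frac{m}{\lceil \log(L+R)\rceil^{10}} > L+R+(LR)^{2/3}. \] Then \[ t\ge d_R^3d_L^3\cdot\min\!\left(1,\ \frac{d_R^3}{L},\ \frac{d_L^2d_R^2}{L^2}\right)\cdot\Omega\!\left(\frac{1}{\log^{70} n}\right). \]
   Context: $\log$ denotes the base-2 logarithm; $\Omega(\cdot)$ hides an absolute positive constant. *)

(* Defs.v *)
From mathcomp Require Import all_boot all_order all_algebra.
From mathcomp Require Import reals exp.

Set Implicit Arguments.
Unset Strict Implicit.
Unset Printing Implicit Defensive.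

Import Order.TTheory GRing.Theory Num.Theory.
Local Open Scope ring_scope.

Definition simple_graph (V : finType) (e : rel V) : Prop :=
  symmetric e /\ irreflexive e.

Definition bipartition (V : finType) (e : rel V) (A B : {set V}) : Prop :=
  [/\ A :|: B = [set: V], [disjoint A & B] &
      forall x y : V, e x y ->
        (x \in A /\ y \in B) \/ (x \in B /\ y \in A)].

Definition edges (V : finType) (e : rel V) : {set {set V}} :=
  [set [set p.1; p.2] | p : V * V & e p.1 p.2].

Definition cycle_edges (V : finType) (c : seq V) : {set {set V}} :=
  [set [set x; next c x] | x in c].

(* A hexagon is a subgraph isomorphic to C_6, represented by its edge set; the
   12 cyclic vertex sequences that traverse it therefore count only once. *)
Definition hexagons (V : finType) (e : rel V) : {set {set {set V}}} :=
  [set cycle_edges c | c : 6.-tuple V & ucycleb e c].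

Definition log2 (K : realType) (x : K) : K := ln x / ln 2.

(* Main.v *)
Require Import Defs.
From mathcomp Require Import all_boot all_order all_algebra.
From mathcomp Require Import reals exp.
From mathcomp Require Import zify ring lra.

Set Implicit Arguments.
Unset Strict Implicit.
Unset Printing Implicit Defensive.

(* Pigeonholing the edges over dyadic degree classes loses a factor l^2, where
   l is the rounded logarithm, and leaves a subgraph with m edges between L and
   R vertices whose maximal degrees are at most about l^2 m/L and l^2 m/R.  It
   has P >= m^3/(128 L R) paths x y1 x1 y; put s = P/(8 L R), which is large by
   the density hypothesis.
   - If at least half of the paths have codegrees of (x, x1) and of (y1, y) at
     most s, then few pairs of paths with common ends x, y share an inner
     vertex, so by Cauchy-Schwarz there are about P^2/(L R) hexagons.
   - If at least a quarter have codegree of (x, x1) above s, dividing by the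
     maximal degree leaves Q >> m^2/(R l^2) paths x1 y1 x with (x, x1) of large
     codegree.  Two of them with the same edge x1 y1 close up to about s^2
     hexagons through their end vertices, x1 and y1, which gives about
     Q^2 s^2/m, that is m^9/(L^4 R^6) up to logarithms.
   - The case of large codegrees of (y1, y) is symmetric, and yields more since
     L <= R. *)

(** * Elementary counting inequalities *)

(** Cauchy-Schwarz against the constant 1, from [2 * (f i * f j) <= f i ^ 2 + f j ^ 2] summed over
    all pairs. *)
Lemma sum_sqr_le (I : finType) (p : pred I) (f : I -> nat) :
  (\sum_(i | p i) f i) ^ 2 <= #|p| * \sum_(i | p i) f i ^ 2.
Proof.
rewrite -(leq_pmul2l (isT : 0 < 2)) -mulnn big_distrlr /= big_distrr /=.
apply: (@leq_trans (\sum_(i | p i) \sum_(j | p j) (f i ^ 2 + f j ^ 2))).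
  apply: leq_sum => i _; rewrite big_distrr /=.
  by apply: leq_sum => j _; apply: nat_Cauchy.
under eq_bigr do rewrite big_split /= sum_nat_const.
by rewrite big_split /= -big_distrr /= sum_nat_const addnn mul2n.
Qed.

Lemma leq_card_sum (T : finType) (A : {set T}) (f : T -> nat) c :
  (forall a, a \in A -> c <= f a) -> #|A| * c <= \sum_a f a.
Proof.
move=> cf; rewrite -sum_nat_const big_mkcond /=.
by apply: leq_sum => a _; case: ifP => // /cf.
Qed.

(** * Paths, codegrees and hexagons in a bipartite graph *)

Section Bipartite.
Variables (X Y : finType).
Implicit Types (r : X -> Y -> bool).

(** A bipartite graph is a relation between two types, so that exchanging its sides is transposing
    the relation. *)
Definition size_rel r := \sum_x \sum_y (r x y : nat).
Definition deg r x := \sum_y (r x y : nat).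
Definition codeg r x x' := #|[set y | r x y && r x' y]|.

Definition path3 r x y1 x1 y :=
  [&& r x y1, r x1 y1, r x1 y, x != x1 & y != y1].

(* The 6-cycle x, y1, x1, y, x2, y2: two paths from x to y. *)
Definition hexagon r x y x1 x2 y1 y2 :=
  [&& r x y1, r x1 y1, r x1 y, r x2 y, r x2 y2, r x y2,
      x != x1, x != x2, x1 != x2, y != y1, y != y2 & y1 != y2].

Definition hexagon_count r :=
  \sum_x \sum_y \sum_x1 \sum_x2 \sum_y1 \sum_y2 (hexagon r x y x1 x2 y1 y2 : nat).

Definition count4 (S : X -> Y -> X -> Y -> bool) :=
  \sum_x \sum_y \sum_x1 \sum_y1 (S x y1 x1 y : nat).

Lemma codegC r x x' : codeg r x x' = codeg r x' x.
Proof. by congr #|pred_of_set _|; apply/setP => y; rewrite !inE andbC. Qed.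

Lemma codeg_sum r x x' : codeg r x x' = \sum_y (r x y && r x' y : nat).
Proof. by rewrite /codeg -sum1dep_card big_mkcond. Qed.

(** The square counts pairs of paths with common ends. Such a pair forms a hexagon unless [x2 = x1]
    or [y2 = y1]; then the other inner vertex of the second path is a common neighbour of [x] and
    [x1], respectively of [y] and [y1]. Hence each path of [S] is the first member of at most
    [2 * s] degenerate pairs. *)
Lemma pairs_of_paths r (s : nat) (S : X -> Y -> X -> Y -> bool) :
  (forall x y1 x1 y, S x y1 x1 y -> path3 r x y1 x1 y) ->
  (forall x y1 x1 y, S x y1 x1 y -> codeg r x x1 <= s) ->
  (forall x y1 x1 y, S x y1 x1 y -> #|[set z | r z y && r z y1]| <= s) ->
  \sum_x \sum_y (\sum_x1 \sum_y1 (S x y1 x1 y : nat)) ^ 2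
    <= hexagon_count r + 2 * s * count4 S.
Proof.
move=> Sp SX SY.
rewrite mul2n -addnn mulnDl /hexagon_count /count4.
rewrite big_distrr /= -!big_split /=; apply: leq_sum => x _.
rewrite big_distrr /= -!big_split /=; apply: leq_sum => y _.
rewrite -mulnn big_distrlr /=.
have hS : forall x1 x2 y1 y2, S x y1 x1 y * S x y2 x2 y <=
  hexagon r x y x1 x2 y1 y2 + ((S x y1 x1 y * ((x2 == x1) * (r x y2 && r x1 y2)))
   + S x y1 x1 y * ((y2 == y1) * (r x2 y && r x2 y1))).
  move=> x1 x2 y1 y2.
  case: (boolP (S x y1 x1 y)) => // S1; case: (boolP (S x y2 x2 y)) => // S2.
  move: (Sp _ _ _ _ S1) (Sp _ _ _ _ S2) => /and5P[a1 a2 a3 a4 a5] /and5P[b1 b2 b3 b4 b5].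
  rewrite /hexagon a1 a2 a3 a4 a5 b1 b2 b3 b4 b5 /= !mul1n.
  case: (eqVneq x2 x1) => [e|n]; first by rewrite -e b2 !addn_gt0 /= ?orbT.
  case: (eqVneq y2 y1) => [e|n']; first by rewrite -e b2 !addn_gt0 /= ?orbT.
  by [].
apply: leq_trans (_ : \sum_x1 \sum_x2 \sum_y1 \sum_y2 _ <= _).
  apply: leq_sum => x1 _; apply: leq_sum => x2 _; rewrite big_distrlr /=.
  by apply: leq_sum => y1 _; apply: leq_sum => y2 _; apply: hS.
under eq_bigr => x1 _.
  under eq_bigr => x2 _.
    under eq_bigr => y1 _ do rewrite !big_split /=.
    rewrite !big_split /=; over.
  rewrite !big_split /=; over.
rewrite !big_split /= leq_add2l leq_add //.
  rewrite big_distrr /=; apply: leq_sum => x1 _.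
  rewrite (bigD1 x1) //= [X in _ + X]big1 ?addn0; last first.
    by move=> x2 /negPf nx; do 2![rewrite big1 // => ? _]; rewrite nx mul0n muln0.
  rewrite big_distrr /=; apply: leq_sum => y1 _.
  rewrite eqxx -big_distrr /=; under eq_bigr do rewrite mul1n.
  rewrite -codeg_sum mulnC.
  by case: (boolP (S x y1 x1 y)) => [/SX|_]; rewrite ?muln1 ?muln0.
rewrite big_distrr /=; apply: leq_sum => x1 _.
rewrite exchange_big big_distrr /=; apply: leq_sum => y1 _.
under eq_bigr => x2 _.
  rewrite (bigD1 y1) //= [X in _ + X]big1 ?addn0; last first.
    by move=> y2 /negPf ny; rewrite ny mul0n muln0.
  rewrite eqxx mul1n; over.
rewrite -big_distrr /= mulnC.
case: (boolP (S x y1 x1 y)) => [/SY|_]; rewrite ?muln1 ?muln0 //.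
by rewrite -sum1dep_card big_mkcond.
Qed.

(** Cauchy-Schwarz over the pairs of ends, all of which lie in [A] times [B]. *)
Lemma count4_sqr (S : X -> Y -> X -> Y -> bool) (A : {set X}) (B : {set Y}) :
  (forall x y1 x1 y, S x y1 x1 y -> (x \in A) && (y \in B)) ->
  count4 S ^ 2 <=
    #|A| * #|B| * \sum_x \sum_y (\sum_x1 \sum_y1 (S x y1 x1 y : nat)) ^ 2.
Proof.
move=> SAB; pose f (p : X * Y) := \sum_x1 \sum_y1 (S p.1 y1 x1 p.2 : nat).
have -> : count4 S = \sum_(p in setX A B) f p.
  rewrite /count4 pair_big /= [RHS]big_mkcond /=; apply: eq_bigr => -[x y] _ /=.
  rewrite in_setX; case: (boolP (_ && _)) => // /negP nAB.
  by do 2![rewrite big1 // => ? _]; case: (boolP (S _ _ _ _)) => // /SAB.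
apply: leq_trans (sum_sqr_le _ _) _.
rewrite -cardsX; apply: leq_mul; first by rewrite leq_eqVlt eqxx.
by rewrite pair_big /= big_mkcond; apply: leq_sum => p _; case: ifP.
Qed.

(** When [r x y] holds, these are the ends [x1] of paths x, y, x1 whose two ends have codegree above
    [s]; [rich_count] counts such paths of length two. *)
Definition rich r s x y := [set x1 | [&& r x1 y, x != x1 & s < codeg r x x1]].
Definition rich_count r s := \sum_x \sum_y r x y * #|rich r s x y|.

(** Over an edge [x y], choose distinct rich [x1] and [x2], then a common neighbour [y1] of [x] and
    [x1], then [y2] of [x] and [x2]. Codegrees are at least [s + 1]: discarding [y] leaves [s]
    choices for [y1], and discarding [y] and [y1] leaves [s - 1] for [y2]. The edge [x y] joins
    opposite vertices of the hexagon. *)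
Lemma rich_hexagons r s :
  \sum_x \sum_y r x y * (#|rich r s x y| * (#|rich r s x y| - 1)) * (s * (s - 1))
    <= hexagon_count r.
Proof.
apply: leq_sum => x _; apply: leq_sum => y _.
case: (boolP (r x y)) => rxy //; rewrite mul1n -mulnA.
apply: leq_card_sum => x1; rewrite inE => /and3P[r1 n1 c1].
apply: leq_trans (_ : #|rich r s x y :\ x1| * (s * (s - 1)) <= _).
  by rewrite leq_mul2r (cardsD1 x1 (rich _ _ _ _)); apply/orP; right; lia.
apply: leq_card_sum => x2; rewrite !inE => /and4P[n12 r2 n2 c2].
apply: leq_trans (_ : #|[set z | r x z && r x1 z] :\ y| * (s - 1) <= _).
  rewrite leq_mul2r; apply/orP; right.
  by move: c1; rewrite /codeg (cardsD1 y); lia.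
apply: leq_card_sum => y1; rewrite !inE => /and3P[m1 a1 b1].
rewrite -[X in X <= _]muln1.
apply: leq_trans (_ : #|[set z | r x z && r x2 z] :\ y :\ y1| * 1 <= _).
  rewrite leq_mul2r /=.
  by move: c2; rewrite /codeg (cardsD1 y) (cardsD1 y1 (_ :\ _));
    case: (y \in _) => /=; case: (y1 \in _) => /=; lia.
apply: leq_card_sum => y2; rewrite !inE => /and4P[m12 m2 a2 b2].
rewrite /hexagon a1 b1 r1 r2 a2 b2 n1 n2 /= [x1 == _]eq_sym n12.
by rewrite [y == _]eq_sym m1 [y == _]eq_sym m2 [y1 == _]eq_sym m12.
Qed.

(** Cauchy-Schwarz over the edges gives [Q ^ 2 <= m * (Q + T)], where [T] counts ordered pairs of
    distinct rich vertices over a common edge. Since [2 * m <= Q], the term [m * Q] is at most half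
    of [Q ^ 2], so [Q ^ 2 <= 2 * m * T]. *)
Lemma rich_count_hexagons r s :
  2 * size_rel r <= rich_count r s ->
  rich_count r s ^ 2 * (s * (s - 1)) <= 2 * size_rel r * hexagon_count r.
Proof.
move=> mQ; set Q := rich_count r s; set m := size_rel r.
pose k x y := #|rich r s x y|.
pose T := \sum_x \sum_y r x y * (k x y * (k x y - 1)).
have QT : Q ^ 2 <= m * (Q + T).
  have -> : Q = \sum_(p : X * Y | r p.1 p.2) k p.1 p.2.
    rewrite /Q /rich_count pair_big /= [RHS]big_mkcond /=.
    by apply: eq_bigr => p _; case: ifP; rewrite ?mul1n.
  apply: leq_trans (sum_sqr_le _ _) _.
  have -> : #|[pred p : X * Y | r p.1 p.2]| = m.
    by rewrite -sum1_card big_mkcond /= /m /size_rel pair_big.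
  rewrite leq_mul2l; apply/orP; right.
  rewrite /T pair_big /= [X in _ <= _ + X](_ : _ =
    \sum_(p : X * Y | r p.1 p.2) k p.1 p.2 * (k p.1 p.2 - 1)); last first.
    by rewrite [RHS]big_mkcond /=; apply: eq_bigr => p _; case: ifP; rewrite ?mul1n.
  by rewrite -big_split /=; apply: leq_sum => p _; case: (k _ _) => // n; nia.
have TH : T * (s * (s - 1)) <= hexagon_count r.
  apply: leq_trans (rich_hexagons r s); rewrite /T big_distrl /=.
  by apply: leq_sum => x _; rewrite big_distrl.
have QT2 : Q ^ 2 <= 2 * m * T by rewrite -/Q -/m in mQ; nia.
apply: leq_trans (_ : 2 * m * T * (s * (s - 1)) <= _).
  by rewrite leq_mul2r QT2 orbT.
by rewrite -mulnA leq_mul2l TH orbT.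
Qed.

(** Removing [y] leaves a rich path x1, y1, x, and [y] is one of at most [D] neighbours of [x1]. *)
Lemma paths_rich r s D : (forall x, deg r x <= D) ->
  count4 (fun x y1 x1 y => path3 r x y1 x1 y && (s < codeg r x x1))
    <= D * rich_count r s.
Proof.
move=> rD; rewrite /count4 /rich_count.
under eq_bigr => x _.
  rewrite exchange_big /=; under eq_bigr => x1 _ do rewrite exchange_big /=.
  over.
rewrite exchange_big big_distrr /=; apply: leq_sum => x1 _.
rewrite exchange_big big_distrr /=; apply: leq_sum => y1 _.
apply: leq_trans (_ : \sum_x r x1 y1 * (x \in rich r s x1 y1) * D <= _).
  apply: leq_sum => x _; apply: leq_trans (leq_mul (leqnn _) (rD x1)).
  rewrite /deg big_distrr /=; apply: leq_sum => y _.
  rewrite inE /path3 [x == x1]eq_sym [codeg r x x1]codegC.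
  by case: (r x y1); case: (r x1 y1); case: (r x1 y); case: (x1 == x);
     case: (y == y1); case: (s < _).
rewrite -big_distrl -big_distrr /= mulnC -sum1_card.
by rewrite [X in _ <= _ * (_ * X)]big_mkcond.
Qed.

End Bipartite.

(** * Exchanging the two sides *)

Lemma hexagon_countT (X Y : finType) (r : X -> Y -> bool) :
  hexagon_count (fun y x => r x y) = hexagon_count r.
Proof.
rewrite /hexagon_count exchange_big /=; apply: eq_bigr => x _.
apply: eq_bigr => y _.
under eq_bigr => y1 _ do rewrite exchange_big /=.
rewrite exchange_big /=; apply: eq_bigr => x1 _.
under eq_bigr => y1 _ do rewrite exchange_big /=.
rewrite exchange_big /=; apply: eq_bigr => x2 _.
apply: eq_bigr => y1 _; apply: eq_bigr => y2 _; congr nat_of_bool.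
by apply/idP/idP; rewrite /hexagon => h; repeat (case/andP: h => ? h);
  do ![apply/andP; split=> //].
Qed.

Lemma paths_richT (X Y : finType) (r : X -> Y -> bool) s D :
  (forall y, deg (fun y x => r x y) y <= D) ->
  count4 (fun x y1 x1 y => path3 r x y1 x1 y &&
                           (s < codeg (fun y x => r x y) y y1))
    <= D * rich_count (fun y x => r x y) s.
Proof.
move=> /(paths_rich s); apply: leq_trans; rewrite /count4 exchange_big /=.
apply: leq_sum => y _; apply: leq_sum => x _; rewrite exchange_big /=.
apply: leq_sum => y1 _; apply: leq_sum => x1 _; rewrite /path3.
by case: (r x y1); case: (r x1 y1); case: (r x1 y); case: (x == x1);
   case: (y == y1).
Qed.

(** * Lower bound for the number of paths of length three *)

Lemma degE (X Y : finType) (r : X -> Y -> bool) x : deg r x = #|[set y | r x y]|.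
Proof. by rewrite /deg -sum1dep_card [RHS]big_mkcond. Qed.

(** Each vertex of degree below [m / (4 * #|A|)] carries fewer than that many edges, and there are
    at most [#|A|] such vertices with an edge. *)
Lemma light_edges (X Y : finType) (r : X -> Y -> bool) (A : {set X}) m :
  (forall x y, r x y -> x \in A) ->
  4 * \sum_x \sum_y (r x y && (4 * #|A| * deg r x < m)) <= m.
Proof.
move=> rA; have [A0|A0] := posnP #|A|.
  rewrite big1 // => x _; rewrite big1 // => y _.
  by case: (boolP (r x y)) => // /rA; rewrite (cards0_eq A0) inE.
rewrite -(leq_pmul2l A0) mulnA [#|A| * 4]mulnC big_distrr /= -sum_nat_const.
rewrite [leqRHS]big_mkcond /=; apply: leq_sum => x _.
case: ifP => [xA|/negP nA].
  case: ltnP => h; last by rewrite big1 ?muln0 // => y _; rewrite andbF.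
  by apply: ltnW; under eq_bigr do rewrite andbT.
rewrite big1 ?muln0 // => y _.
by case: (boolP (r x y)) => // /rA.
Qed.

(** A path through a middle edge needs a second neighbour at each end. Here [d >= 2], so excluding
    one neighbour at most halves the degree. *)
Lemma half_deg a d m : 8 * a <= m -> m <= 4 * a * d -> m <= 8 * a * (d - 1).
Proof.
move=> am md; case: (posnP a) => [a0|a0]; first by rewrite a0 in md *; lia.
have : 4 * a * 2 <= 4 * a * d by lia.
by rewrite leq_pmul2l ?muln_gt0 //; case: d md => [|[|d]] // + _; nia.
Qed.

(** Discarding the edges with an end of degree below a quarter of the average on its side keeps at
    least half of them. Each kept edge is the middle of at least [m ^ 2 / (64 * #|A| * #|B|)]
    paths. *)
Lemma count_path3 (X Y : finType) (r : X -> Y -> bool) (A : {set X}) (B : {set Y}) :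
  (forall x y, r x y -> (x \in A) && (y \in B)) ->
  8 * #|A| <= size_rel r -> 8 * #|B| <= size_rel r ->
  size_rel r ^ 3 <= 128 * (#|A| * #|B|) * count4 (path3 r).
Proof.
set m := size_rel r => rAB mA mB.
pose rT y x := r x y.
pose hA x := 4 * #|A| * deg r x < m.
pose hB y := 4 * #|B| * deg rT y < m.
have lA : 4 * \sum_x \sum_y (r x y && hA x) <= m.
  by apply: light_edges => x y /rAB/andP[].
have lB : 4 * \sum_y \sum_x (rT y x && hB y) <= m.
  by apply: light_edges => x y /rAB/andP[].
pose h := \sum_x \sum_y [&& r x y, ~~ hA x & ~~ hB y].
have mh : m <= 2 * h.
  suff : m <= h + \sum_x \sum_y (r x y && hA x) + \sum_y \sum_x (rT y x && hB y).
    by lia.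
  rewrite [X in _ + X]exchange_big /= /h /m /size_rel -!big_split /=.
  apply: leq_sum => x _; rewrite -!big_split /=; apply: leq_sum => y _.
  by rewrite /rT; case: (r x y); case: (hA x); case: (hB y).
rewrite expnS.
apply: leq_trans (_ : 2 * h * m ^ 2 <= _); first by rewrite leq_mul2r mh orbT.
rewrite (_ : 128 * _ = 2 * (64 * (#|A| * #|B|))); last by lia.
rewrite -mulnA -[leqRHS]mulnA leq_pmul2l // /count4.
under [X in _ <= _ * X]eq_bigr => x _.
  rewrite exchange_big /=; under eq_bigr => x1 _ do rewrite exchange_big /=.
  over.
rewrite [X in _ <= _ * X]exchange_big /=.
rewrite /h [leqRHS]big_distrr [leqLHS]big_distrl /=; apply: leq_sum => x1 _.
rewrite exchange_big [leqRHS]big_distrr [leqLHS]big_distrl /=; apply: leq_sum => y1 _.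
case: (boolP (r x1 y1)) => // r1; case: (boolP (hA x1)) => // hx.
case: (boolP (hB y1)) => // hy; rewrite mul1n.
move: hx hy; rewrite /hA /hB -!leqNgt => hx hy.
have dA := half_deg mA hx.
have dB := half_deg mB hy.
have -> : \sum_x \sum_y (path3 r x y1 x1 y : nat)
    = #|[set x | r x y1] :\ x1| * #|[set y | r x1 y] :\ y1|.
  rewrite -!sum1_card [X in _ = X * _]big_mkcond [X in _ = _ * X]big_mkcond /=.
  rewrite big_distrlr /=; apply: eq_bigr => x _; apply: eq_bigr => y _.
  rewrite !inE /path3 r1; case: (r x y1); case: (r x1 y); case: (x == x1);
   by case: (y == y1).
have -> : #|[set x | r x y1] :\ x1| = deg rT y1 - 1.
  by rewrite degE (cardsD1 x1 [set x | rT y1 x]) inE /rT r1 add1n subn1.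
have -> : #|[set y | r x1 y] :\ y1| = deg r x1 - 1.
  by rewrite degE (cardsD1 y1 [set y | r x1 y]) inE r1 add1n subn1.
by rewrite -mulnn; apply: leq_trans (leq_mul dA dB) _; lia.
Qed.

(** * From paths to hexagons: three cases *)

(** Every path has both codegrees at most [s] or is covered by one of the two rich counts; so half
    of the paths are of the first type, or one of the rich counts covers a quarter. *)
Lemma hexagon_trichotomy (X Y : finType) (r : X -> Y -> bool) (A : {set X})
    (B : {set Y}) s DA DB :
  let rT y x := r x y in
  let P := count4 (path3 r) in
  (forall x y, r x y -> (x \in A) && (y \in B)) ->
  (forall x, deg r x <= DA) -> (forall y, deg rT y <= DB) ->
  8 * s * (#|A| * #|B|) <= P ->
  [\/ P ^ 2 <= 8 * (#|A| * #|B|) * hexagon_count r,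
      P <= 4 * (DA * rich_count r s) | P <= 4 * (DB * rich_count rT s)].
Proof.
move=> rT P rAB rDA rDB sP.
pose S x y1 x1 y :=
  [&& path3 r x y1 x1 y, codeg r x x1 <= s & codeg rT y y1 <= s].
have P3 : P <= count4 S + DA * rich_count r s + DB * rich_count rT s.
  apply: leq_trans (leq_add (leq_add (leqnn _) (paths_rich s rDA))
                            (paths_richT s rDB)).
  rewrite /P /count4 -!big_split; do 4![apply: leq_sum => ? _; rewrite -?big_split /=].
  by rewrite /S; case: (path3 _ _ _ _ _); case: leqP => //; case: leqP.
case: (leqP P (4 * (DA * rich_count r s))) => [|hA]; first by constructor 2.
case: (leqP P (4 * (DB * rich_count rT s))) => [|hB]; first by constructor 3.
constructor 1.
have PS : P <= 2 * count4 S by lia.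
have h1 : count4 S ^ 2 <= #|A| * #|B| * (hexagon_count r + 2 * s * count4 S).
  apply: leq_trans (count4_sqr (A := A) (B := B) _) _.
    by move=> x y1 x1 y /and3P[/and5P[/rAB/andP[-> _] _ /rAB/andP[_ ->]]].
  rewrite leq_mul2l; apply/orP; right.
  by apply: pairs_of_paths => x y1 x1 y /and3P[].
move: h1 PS sP; move: (count4 S) (#|A| * #|B|) (hexagon_count r) => c a H.
(* The degenerate term [2 * s * a * c] is now at most half of [c ^ 2], so [c ^ 2 <= 2 * a * H], and
   [P <= 2 * c] costs a further factor 4. *)
clear=> h1 PS sP; have sc : 4 * (s * a) <= c by lia.
have := leq_mul sc (leqnn c); have := leq_mul PS PS.
by rewrite !mulnn; lia.
Qed.

(** Multiplying the squares of the bounds for [Q] and [s] produces [m ^ 10]; one factor [m]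
    cancels. *)
Lemma combine_bounds m Q s H c1 c2 : 0 < m ->
  m ^ 2 <= c1 * Q -> m ^ 3 <= c2 * s -> Q ^ 2 * s ^ 2 <= 4 * m * H ->
  m ^ 9 <= 4 * c1 ^ 2 * c2 ^ 2 * H.
Proof.
move=> m0 hQ hs hH; rewrite -(leq_pmul2l m0) -expnS.
rewrite (_ : m ^ 10 = (m ^ 2) ^ 2 * (m ^ 3) ^ 2); last by rewrite -!expnM -expnD.
have hQ2 : (m ^ 2) ^ 2 <= (c1 * Q) ^ 2 by rewrite leq_exp2r.
have hs2 : (m ^ 3) ^ 2 <= (c2 * s) ^ 2 by rewrite leq_exp2r.
apply: leq_trans (leq_mul hQ2 hs2) _.
rewrite !expnMn mulnACA.
apply: leq_trans (leq_mul (leqnn _) hH) _.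
by rewrite -!mulnA; lia.
Qed.

(** * Dyadic regularisation of the degrees *)

(** Edges are sorted by the rounded logarithms of the degrees of their ends, and the largest of the
    [l ^ 2] classes is kept. The classes refer to degrees in [r]: these bound the degrees in [r']
    from above, and they bound [#|A|] and [#|B|] because each chosen vertex has many edges of
    [r]. *)
Lemma regular_subgraph (X Y : finType) (r : X -> Y -> bool) l : 0 < l ->
  (forall x, deg r x < 2 ^ l) -> (forall y, deg (fun y x => r x y) y < 2 ^ l) ->
  exists (r' : X -> Y -> bool) (A : {set X}) (B : {set Y}) (DA DB : nat),
    [/\ forall x y, r' x y -> [&& r x y, x \in A & y \in B],
        (forall x, x \in A -> 0 < deg r x) /\
        (forall y, y \in B -> 0 < deg (fun y x => r x y) y),
        (forall x, deg r' x <= DA) /\ (forall y, deg (fun y x => r' x y) y <= DB),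
        #|A| * DA <= 2 * size_rel r /\ #|B| * DB <= 2 * size_rel r
      & size_rel r <= l ^ 2 * size_rel r'].
Proof.
move=> l0 rX rY; pose rT y x := r x y.
pose cX x := trunc_log 2 (deg r x); pose cY y := trunc_log 2 (deg rT y).
have cl d : d < 2 ^ l -> trunc_log 2 d < l.
  case: d => [|d] dl; first by rewrite trunc_log0.
  by rewrite -(ltn_exp2l _ _ (isT : 1 < 2)); apply: leq_ltn_trans dl; apply: trunc_logP.
pose q (p : 'I_l * 'I_l) x y := [&& r x y, cX x == p.1 & cY y == p.2].
pose p0 : 'I_l * 'I_l := (Ordinal l0, Ordinal l0).
have [p _ pmax] := @arg_maxnP _ p0 predT (fun p => size_rel (q p)) isT.
(* Since [trunc_log 2 0 = 0], isolated vertices would fall into class 0; positivity excludes them,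
   so that every vertex of the first set has degree at least [2 ^ p.1], and likewise for the
   second. *)
exists (q p), [set x | (0 < deg r x) && (cX x == p.1)],
  [set y | (0 < deg rT y) && (cY y == p.2)], (2 * 2 ^ p.1), (2 * 2 ^ p.2).
have deg_gt0 x y : r x y -> 0 < deg r x.
  by move=> rxy; rewrite /deg (bigD1 y) //= rxy.
have degT_gt0 x y : r x y -> 0 < deg rT y.
  by move=> rxy; rewrite /deg (bigD1 x) //= /rT rxy.
split.
- move=> x y /and3P[rxy c1 c2]; rewrite !inE rxy c1 c2 !andbT /=.
  by rewrite (deg_gt0 _ _ rxy) (degT_gt0 _ _ rxy).
- by split=> z; rewrite inE => /andP[].
- split=> z; rewrite -expnS.
    case: (eqVneq (cX z) p.1) => [e|n]; last first.
      by rewrite /deg big1 // => y _; rewrite /q (negPf n) andbF.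
    apply: leq_trans (ltnW (_ : deg r z < _)); last first.
      by rewrite -e; apply: trunc_log_ltn.
    by apply: leq_sum => y _; rewrite /q; case: (r z y) => //=; case: (_ && _).
  case: (eqVneq (cY z) p.2) => [e|n]; last first.
    by rewrite /deg big1 // => y _; rewrite /q (negPf n) !andbF.
  apply: leq_trans (ltnW (_ : deg rT z < _)); last first.
    by rewrite -e; apply: trunc_log_ltn.
  apply: leq_sum => y _; rewrite /q /rT; case: (r y z) => //=.
  by case: (_ && _).
- rewrite !mulnA ![_ * 2]mulnC -!mulnA !leq_pmul2l //; split.
    apply: leq_card_sum => x; rewrite inE => /andP[d0 /eqP<-].
    exact: trunc_logP.
  rewrite /size_rel exchange_big /=; apply: leq_card_sum => y.
  by rewrite inE => /andP[d0 /eqP<-]; apply: trunc_logP.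
apply: leq_trans (_ : \sum_(p : 'I_l * 'I_l) size_rel (q p) <= _); last first.
  have -> : l ^ 2 = #|{: 'I_l * 'I_l}| by rewrite card_prod !card_ord mulnn.
  rewrite -sum_nat_const.
  by apply: leq_sum => p' _; apply: pmax.
rewrite /size_rel [leqRHS]exchange_big /=; apply: leq_sum => x _.
rewrite [leqRHS]exchange_big /=; apply: leq_sum => y _.
case: (boolP (r x y)) => // rxy.
rewrite (bigD1 (Ordinal (cl _ (rX x)), Ordinal (cl _ (rY y)))) //=.
by rewrite /q rxy !eqxx.
Qed.

(** * Labelled hexagons and hexagons as edge sets *)

Lemma leq_card_fibers (T T' : finType) (U : {set T}) (f : T -> T') k :
  (forall c, c \in U -> #|[set c' in U | f c' == f c]| <= k) ->
  #|U| <= #|[set f c | c in U]| * k.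
Proof.
move=> fib; rewrite -sum1_card (partition_big_imset f) /=.
rewrite -sum_nat_const; apply: leq_sum => S /imsetP[c Uc ->].
by rewrite sum1dep_card; apply: fib.
Qed.

(** Every vertex of [c'] is an end of one of its edges, and the ends of the edges of [c] lie on
    [c]. *)
Lemma mem_cycle_edges (V : finType) (c c' : seq V) x :
  cycle_edges c' = cycle_edges c -> x \in c' -> x \in c.
Proof.
move=> ec xc; have : [set x; next c' x] \in cycle_edges c'.
  by apply/imsetP; exists x.
rewrite ec => /imsetP[y yc /setP/(_ x)]; rewrite !inE eqxx /=.
by move/esym/orP=> [] /eqP->; rewrite ?mem_next.
Qed.

(* A closed 6-walk with prescribed edge set takes its 6 entries among the same 6
   vertices. *)
Lemma card_ucycles_hexagons (V : finType) (e : rel V) :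
  #|[set c : 6.-tuple V | ucycleb e c]| <= #|hexagons e| * 6 ^ 6.
Proof.
have -> : hexagons e =
    [set cycle_edges (val c) | c in [set c : 6.-tuple V | ucycleb e c]].
  by apply/setP => S; apply/imsetP/imsetP => -[c Uc ->]; exists c;
     rewrite ?inE // in Uc *.
apply: leq_card_fibers => c _.
pose g (c' : 6.-tuple V) : 6.-tuple 'I_6 :=
  [tuple of map (fun x => inord (index x c)) c'].
rewrite -[X in _ <= X ^ _]card_ord -card_tuple.
rewrite -(card_in_imset (f := g)) ?max_card // => c1 c2.
rewrite !inE => /andP[_ /eqP e1] /andP[_ /eqP e2] /(congr1 val) /= g12.
apply: val_inj; apply: (@eq_from_nth _ (thead c)); rewrite ?size_tuple // => i i6.
have n1 : nth (thead c) c1 i \in (c : seq V).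
  by apply: (mem_cycle_edges e1); rewrite mem_nth ?size_tuple.
have n2 : nth (thead c) c2 i \in (c : seq V).
  by apply: (mem_cycle_edges e2); rewrite mem_nth ?size_tuple.
have /(congr1 (fun s => nth ord0 s i)) := g12.
rewrite !(nth_map (thead c)) ?size_tuple // => /(congr1 val) /=.
have i1 : index (nth (thead c) c1 i) c < 6 by move: n1; rewrite -index_mem size_tuple.
have i2 : index (nth (thead c) c2 i) c < 6 by move: n2; rewrite -index_mem size_tuple.
rewrite !inordK // => /(congr1 (nth (thead c) c)).
by rewrite !nth_index.
Qed.

(** [hexagon] compares vertices within each side only; disjointness of [A] and [B] supplies the
    other inequalities that make x, y1, x1, y, x2, y2 a 6-cycle. *)
Lemma hexagon_count_le (V : finType) (e r : rel V) (A B : {set V}) :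
  symmetric e -> [disjoint A & B] ->
  (forall x y, r x y -> [&& e x y, x \in A & y \in B]) ->
  hexagon_count r <= #|hexagons e| * 6 ^ 6.
Proof.
move=> esym dAB rAB; apply: leq_trans (card_ucycles_hexagons e).
rewrite /hexagon_count !pair_big /=.
pose F (h : V * V * V * V * V * V) : 6.-tuple V :=
  let: (x, y, x1, x2, y1, y2) := h in [tuple x; y1; x1; y; x2; y2].
have Finj : injective F.
  move=> [[[[[x y] x1] x2] y1] y2] [[[[[x' y'] x1'] x2'] y1'] y2'].
  by case=> -> -> -> -> -> ->.
pose U := [set h : V * V * V * V * V * V |
  let: (x, y, x1, x2, y1, y2) := h in hexagon r x y x1 x2 y1 y2].
apply: (@leq_trans #|U|).
  rewrite -sum1_card [leqRHS]big_mkcond /=; apply: leq_sum.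
  by move=> [[[[[x y] x1] x2] y1] y2] _ /=; rewrite inE; case: ifP.
rewrite -(card_imset _ Finj); apply/subset_leq_card/subsetP => c /imsetP[h].
case: h => [[[[[x y] x1] x2] y1] y2]; rewrite !inE => h -> /=.
have nAB a b : a \in A -> b \in B -> a != b.
  by move=> aA bB; apply: contraTneq bB => <-; move/disjointFr: dAB => ->.
move: h; rewrite /hexagon.
move=> /and5P[/rAB/and3P[E1 xA y1B] /rAB/and3P[E2 x1A _] /rAB/and3P[E3 _ yB]
  /rAB/and3P[E4 x2A _] /and5P[/rAB/and3P[E5 _ y2B] /rAB/and3P[E6 _ _] n1 n2
  /and4P[n3 n4 n5 n6]]].
rewrite /ucycleb /= E1 [e y1 _]esym E2 E3 [e y _]esym E4 E5 [e y2 _]esym E6 /=.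
rewrite !inE !negb_or n1 n2 n3 n5 n6 [y1 == y]eq_sym n4 /=.
rewrite [y1 == x1]eq_sym [y1 == x2]eq_sym [y == x2]eq_sym.
by rewrite (nAB x y1) ?(nAB x y) ?(nAB x y2) ?(nAB x1 y1) ?(nAB x2 y1)
  ?(nAB x1 y) ?(nAB x1 y2) ?(nAB x2 y) ?(nAB x2 y2).
Qed.

Lemma edges_le_size (V : finType) (e : rel V) (A B : {set V}) :
  symmetric e -> bipartition e A B ->
  #|edges e| <= size_rel (fun x y => [&& e x y, x \in A & y \in B]).
Proof.
move=> esym [_ _ eAB].
pose E := [set p : V * V | [&& e p.1 p.2, p.1 \in A & p.2 \in B]].
have -> : size_rel (fun x y => [&& e x y, x \in A & y \in B]) = #|E|.
  by rewrite -sum1_card [RHS]big_mkcond /size_rel pair_big /=;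
     apply: eq_bigr => p _; rewrite inE; case: ifP.
apply: leq_trans (leq_imset_card (fun p : V * V => [set p.1; p.2]) E).
apply/subset_leq_card/subsetP => S /imsetP[[x y] /=]; rewrite inE /= => exy ->.
apply/imsetP; case: (eAB _ _ exy) => -[xA yB].
  by exists (x, y); rewrite // inE /= exy xA.
by exists (y, x); rewrite ?inE /= ?[e y x]esym ?exy ?xA ?yB // setUC.
Qed.

(** * Hexagons in the regular subgraph and in the whole graph *)

(** The number [k] bounds the ratio of the maximal degrees to [m / #|A|] and [m / #|B|]. *)
Lemma dense_hexagons (X Y : finType) (r : X -> Y -> bool) (A : {set X})
    (B : {set Y}) DA DB k :
  let rT y x := r x y in
  let m := size_rel r in let a := #|A| * #|B| in
  (forall x y, r x y -> (x \in A) && (y \in B)) ->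
  (forall x, deg r x <= DA) -> (forall y, deg rT y <= DB) ->
  0 < k -> 0 < a -> #|A| * DA <= k * m -> #|B| * DB <= k * m ->
  1024 * k * #|A| <= m -> 1024 * k * #|B| <= m -> 2048 * a ^ 2 <= m ^ 3 ->
  [\/ m ^ 6 <= (128 * a) ^ 2 * (8 * a * hexagon_count r),
      m ^ 9 <= 4 * (512 * k * #|B|) ^ 2 * (2048 * a ^ 2) ^ 2 * hexagon_count r |
      m ^ 9 <= 4 * (512 * k * #|A|) ^ 2 * (2048 * a ^ 2) ^ 2 * hexagon_count r].
Proof.
move=> rT m a rAB rDA rDB k0 a0 kA kB mA mB am.
have [A0 B0] : 0 < #|A| /\ 0 < #|B| by move: a0; rewrite muln_gt0 => /andP[].
have m0 : 0 < m by apply: leq_trans mA; rewrite !muln_gt0 k0 A0.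
have hP : m ^ 3 <= 128 * a * count4 (path3 r).
  apply: count_path3 => //; [apply: leq_trans mA|apply: leq_trans mB];
    by rewrite leq_mul2r; apply/orP; right; lia.
set P := count4 (path3 r) in hP *; set H := hexagon_count r.
(* The largest threshold the trichotomy allows. As [2048 = 128 * 16], the density hypothesis gives
   [P >= 16 * a], hence [s >= 2]; rounding down and replacing [s] by [s - 1] then cost a factor 2
   each. *)
pose s := P %/ (8 * a).
have sP : 8 * s * a <= P by rewrite mulnAC mulnC leq_divM.
have P16 : 16 * a <= P.
  have : 128 * a * (16 * a) <= 128 * a * P by apply: leq_trans hP; lia.
  by rewrite leq_pmul2l // muln_gt0.
have s2 : 2 <= s by rewrite leq_divRL; lia.
have Ps : P <= 16 * a * s.
  have : P < s.+1 * (8 * a) by rewrite ltn_ceil // muln_gt0.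
  have : 8 * a * 2 <= 8 * a * s by rewrite leq_mul2l s2 orbT.
  by lia.
have ms : m ^ 3 <= 2048 * a ^ 2 * s.
  apply: leq_trans hP _; apply: leq_trans (leq_mul (leqnn _) Ps) _; lia.
(* Both cases of large codegree at once: [b] is the size of the side where [D] bounds the degrees,
   [c] that of the other. Replacing [b * D] by [k * m] cancels one [m] from the path bound, and
   [1024 * k * c <= m] then gives [2 * m <= Q]. *)
have rich_case (Z W : finType) (q : Z -> W -> bool) c b D : size_rel q = m ->
    hexagon_count q = H -> a = b * c -> 0 < c -> b * D <= k * m ->
    1024 * k * c <= m ->
    P <= 4 * (D * rich_count q s) ->
    m ^ 9 <= 4 * (512 * k * c) ^ 2 * (2048 * a ^ 2) ^ 2 * H.
  move=> qm qH abc c0 bD cm PQ; set Q := rich_count q s in PQ.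
  have mQ : m ^ 2 <= 512 * k * c * Q.
    rewrite -(leq_pmul2l m0) -expnS; apply: leq_trans hP _.
    apply: leq_trans (leq_mul (leqnn _) PQ) _.
    rewrite (_ : _ * _ = 512 * c * Q * (b * D)); last by rewrite abc; lia.
    rewrite (_ : m * _ = 512 * c * Q * (k * m)); last by lia.
    by rewrite leq_mul2l bD orbT.
  have Q2m : 2 * m <= Q.
    have c'0 : 0 < 512 * k * c by rewrite !muln_gt0 k0.
    rewrite -(leq_pmul2l c'0); apply: leq_trans mQ.
    by rewrite -mulnn; apply: leq_trans (leq_mul cm (leqnn m)); lia.
  apply: combine_bounds m0 mQ ms _; rewrite -qH.
  have := rich_count_hexagons (r := q) (s := s); rewrite qm -/Q => /(_ Q2m) hQ.
  have ss : s ^ 2 <= 2 * (s * (s - 1)).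
    by rewrite -mulnn mulnCA leq_mul2l; apply/orP; right; lia.
  apply: leq_trans (leq_mul (leqnn _) ss) _; rewrite mulnCA.
  by apply: leq_trans (leq_mul (leqnn _) hQ) _; rewrite !mulnA.
case: (hexagon_trichotomy rAB rDA rDB sP) => h.
- constructor 1; rewrite (_ : m ^ 6 = (m ^ 3) ^ 2); last by rewrite -expnM.
  apply: (@leq_trans ((128 * a * P) ^ 2)); first by rewrite leq_exp2r.
  by rewrite expnMn leq_mul2l h orbT.
- by constructor 2; apply: rich_case h.
- constructor 3; apply: (rich_case _ _ rT #|A| #|B| DB _ _ _ A0 kB mA h).
  + by rewrite /m /size_rel exchange_big.
  + exact: hexagon_countT.
  + by rewrite /a mulnC.
Qed.

Lemma size_rel_gt0 (X Y : finType) (r : X -> Y -> bool) (A : {set X}) (B : {set Y}) :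
  (forall x y, r x y -> (x \in A) && (y \in B)) ->
  0 < size_rel r -> 0 < #|A| * #|B|.
Proof.
move=> rAB; apply: contraTT; rewrite -!eqn0Ngt -cardsX cards_eq0 => /eqP AB0.
rewrite /size_rel big1 // => x _; rewrite big1 // => y _.
by case: (boolP (r x y)) => // /rAB; rewrite -in_setX AB0 inE.
Qed.

(** The subgraph keeps [M / l ^ 2] edges, so the powers 6 and 9 lose [l ^ 12] and [l ^ 18], and [k]
    is [2 * l ^ 2]. Since [#|A| <= #|B|], the two cases of large codegree share one bound. *)
Lemma bipartite_hexagons (V : finType) (e : rel V) (A B : {set V}) l :
  let M := size_rel (fun x y => [&& e x y, x \in A & y \in B]) in
  let a := #|A| * #|B| in
  let h := #|hexagons e| * 6 ^ 6 in
  simple_graph e -> bipartition e A B ->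
  7 < l -> #|A| + #|B| <= 2 ^ l -> 0 < #|A| -> #|A| <= #|B| ->
  l ^ 10 * (#|A| + #|B|) <= M -> l ^ 30 * a ^ 2 <= M ^ 3 ->
  M ^ 6 <= l ^ 12 * ((128 * a) ^ 2 * (8 * a * h)) \/
  M ^ 9 <= l ^ 18 * (4 * (512 * (2 * l ^ 2) * #|B|) ^ 2 * (2048 * a ^ 2) ^ 2 * h).
Proof.
move=> M a h [esym _] [_ dAB _] l8 nl A0 AB MAB Ma.
pose r x y := [&& e x y, x \in A & y \in B].
have B0 : 0 < #|B| by apply: leq_trans AB.
have l0 : 0 < l by lia.
have rX x : deg r x < 2 ^ l.
  apply: leq_trans nl; rewrite degE; apply: (@leq_ltn_trans #|B|); last by lia.
  by apply/subset_leq_card/subsetP => y; rewrite inE => /and3P[].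
have rY y : deg (fun y x => r x y) y < 2 ^ l.
  apply: leq_trans nl; rewrite degE; apply: (@leq_ltn_trans #|A|); last by lia.
  by apply/subset_leq_card/subsetP => x; rewrite inE => /and3P[].
have [r' [A' [B' [DA [DB [rr' [A'0 B'0] [rDA rDB] [AD BD] Mm]]]]]] :=
  regular_subgraph l0 rX rY.
rewrite -/M in AD BD Mm; set m := size_rel r' in Mm.
have A'A : #|A'| <= #|A|.
  apply/subset_leq_card/subsetP => x /A'0; rewrite degE => /card_gt0P[y].
  by rewrite inE => /and3P[].
have B'B : #|B'| <= #|B|.
  apply/subset_leq_card/subsetP => x /B'0; rewrite degE => /card_gt0P[y].
  by rewrite inE => /and3P[].
have rAB' x y : r' x y -> (x \in A') && (y \in B') by move/rr'/and3P=> [_ -> ->].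
have hr' : hexagon_count r' <= h.
  by apply: hexagon_count_le esym dAB _ => x y /rr'/and3P[].
have M0 : 0 < M by apply: leq_trans MAB; rewrite muln_gt0 expn_gt0 l0 addn_gt0 A0.
have m0 : 0 < m by move: (leq_trans M0 Mm); rewrite muln_gt0 => /andP[].
have a'0 : 0 < #|A'| * #|B'| by apply: size_rel_gt0 rAB' m0.
have a'a : #|A'| * #|B'| <= a by apply: leq_mul.
(* Spare powers of [l] in the density hypotheses absorb the numerical constants. *)
have l4 : 2048 <= l ^ 4 by apply: leq_trans (_ : 8 ^ 4 <= _); rewrite // leq_exp2r.
have cm c : c <= #|A| + #|B| -> 1024 * (2 * l ^ 2) * c <= m.
  move=> cAB; have l2 : 0 < l ^ 2 by rewrite expn_gt0 l0.
  rewrite -(leq_pmul2l l2); apply: leq_trans Mm; apply: leq_trans MAB.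
  rewrite mulnA leq_mul // (_ : 10 = 2 + (4 + 2 + 2)) // !expnD leq_mul2l.
  apply/orP; right; rewrite mulnA (_ : 1024 * 2 = 2048) //.
  apply: (@leq_trans (l ^ 4 * l ^ 2)); first by rewrite leq_mul.
  by rewrite leq_pmulr.
have m3 : 2048 * (#|A'| * #|B'|) ^ 2 <= m ^ 3.
  have l6 : 0 < (l ^ 2) ^ 3 by rewrite !expn_gt0 l0.
  rewrite -(leq_pmul2l l6) -expnMn.
  apply: (@leq_trans (M ^ 3)); last by rewrite leq_exp2r.
  apply: leq_trans Ma; rewrite mulnA leq_mul ?leq_exp2r //.
  rewrite -expnM (_ : 30 = 2 * 3 + (4 + 20)) // !expnD leq_mul2l.
  by apply/orP; right; apply: (leq_trans l4); rewrite leq_pmulr // expn_gt0 l0.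
have kA c D : c * D <= 2 * M -> c * D <= 2 * l ^ 2 * m.
  by move=> cD; apply: leq_trans cD _; rewrite -mulnA leq_mul2l.
have k0 : 0 < 2 * l ^ 2 by rewrite muln_gt0 expn_gt0 l0.
have Mm6 : M ^ 6 <= l ^ 12 * m ^ 6.
  by rewrite (_ : 12 = 2 * 6) // expnM -expnMn leq_exp2r.
have Mm9 : M ^ 9 <= l ^ 18 * m ^ 9.
  by rewrite (_ : 18 = 2 * 9) // expnM -expnMn leq_exp2r.
have := dense_hexagons rAB' rDA rDB k0 a'0 (kA _ _ AD) (kA _ _ BD)
  (cm _ (leq_trans A'A (leq_addr _ _))) (cm _ (leq_trans B'B (leq_addl _ _))) m3.
have rich_case c : c <= #|B| ->
    m ^ 9 <= 4 * (512 * (2 * l ^ 2) * c) ^ 2 *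
      (2048 * (#|A'| * #|B'|) ^ 2) ^ 2 * hexagon_count r' ->
    M ^ 9 <= l ^ 18 * (4 * (512 * (2 * l ^ 2) * #|B|) ^ 2 * (2048 * a ^ 2) ^ 2 * h).
  move=> cB hm; apply: (leq_trans Mm9); apply: leq_mul => //.
  apply: (leq_trans hm); apply: leq_mul => //; apply: leq_mul.
    by rewrite leq_mul2l leq_exp2r // leq_mul2l cB !orbT.
  by rewrite leq_exp2r // leq_mul2l leq_exp2r // a'a orbT.
case=> hm; [left | right | right].
- apply: (leq_trans Mm6); apply: leq_mul => //; apply: (leq_trans hm).
  by apply: leq_mul; rewrite ?leq_exp2r // leq_mul // leq_mul2l a'a orbT.
- exact: rich_case hm.
- by apply: rich_case hm; apply: leq_trans AB.
Qed.

(** * Real arithmetic and conclusion *)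

Import Order.TTheory GRing.Theory Num.Theory.
Local Open Scope ring_scope.

(** The minimum is bounded by 1 in the first case and by [(m / R) ^+ 3 / L] in the second, which
    leaves [m ^+ 6 / a ^+ 3] and [m ^+ 9 / (L ^+ 4 * R ^+ 6)]. Both are at most
    [2 ^+ 44 * l ^+ 22 * h], and [l <= 2 * g] contributes another [2 ^+ 22]. *)
Lemma hexagon_bound_arith (K : realFieldType) (m L R l g t : K) :
  let h := t * 6 ^+ 6 in let a := L * R in
  0 < L -> 0 < R -> 0 <= m -> 1 <= l -> 1 <= g -> l <= 2 * g -> 0 <= t ->
  m ^+ 6 <= l ^+ 12 * ((128 * a) ^+ 2 * (8 * a * h)) \/
  m ^+ 9 <= l ^+ 18 * (4 * (512 * (2 * l ^+ 2) * R) ^+ 2 * (2048 * a ^+ 2) ^+ 2 * h) ->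
  (m / R) ^+ 3 * (m / L) ^+ 3 *
    Num.min 1 (Num.min ((m / R) ^+ 3 / L) ((m / L) ^+ 2 * (m / R) ^+ 2 / L ^+ 2)) *
    ((2 ^+ 66 * 6 ^+ 6)^-1 * (1 / g ^+ 70)) <= t.
Proof.
move=> h a L0 R0 m0 l1 g1 lg t0 hm.
have h0 : 0 <= h by rewrite mulr_ge0 ?exprn_ge0.
have d0 : 0 <= (m / R) ^+ 3 * (m / L) ^+ 3.
  by rewrite mulr_ge0 // exprn_ge0 // divr_ge0 // ltW.
have g0 : 0 < g by apply: lt_le_trans g1.
have l0 : 0 < l by apply: lt_le_trans l1.
set D := _ * Num.min _ _.
have Dl : D <= 2 ^+ 44 * l ^+ 22 * h.
  case: hm => hm.
    apply: (@le_trans _ _ ((m / R) ^+ 3 * (m / L) ^+ 3 * 1)).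
      by apply: ler_wpM2l => //; rewrite ge_min lexx.
    have -> : (m / R) ^+ 3 * (m / L) ^+ 3 * 1 = m ^+ 6 / a ^+ 3.
      by rewrite /a; field; rewrite !gt_eqF.
    have a0 : 0 < a ^+ 3 by rewrite exprn_gt0 // mulr_gt0.
    rewrite ler_pdivrMr //; apply: (le_trans hm).
    rewrite (_ : _ * _ = 2 ^+ 17 * (l ^+ 12 * (h * a ^+ 3))); last by ring.
    rewrite [leRHS](_ : _ =
      2 ^+ 17 * (2 ^+ 27 * l ^+ 10 * (l ^+ 12 * (h * a ^+ 3)))); last by ring.
    apply: ler_wpM2l; first by rewrite exprn_ge0.
    apply: ler_peMl; first by rewrite !mulr_ge0 ?exprn_ge0 // ltW.
    by rewrite mulr_ege1 ?exprn_ege1 // ler1n.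
  apply: (@le_trans _ _ ((m / R) ^+ 3 * (m / L) ^+ 3 * ((m / R) ^+ 3 / L))).
    by apply: ler_wpM2l => //; rewrite !ge_min lexx orbT.
  have -> : (m / R) ^+ 3 * (m / L) ^+ 3 * ((m / R) ^+ 3 / L) = m ^+ 9 / (L ^+ 4 * R ^+ 6).
    by field; rewrite !gt_eqF.
  have a0 : 0 < L ^+ 4 * R ^+ 6 by rewrite mulr_gt0 ?exprn_gt0.
  rewrite ler_pdivrMr //; apply: (le_trans hm).
  by rewrite le_eqVlt; apply/orP; left; apply/eqP; rewrite /a; ring.
have lg22 : l ^+ 22 <= 2 ^+ 22 * g ^+ 70.
  apply: (@le_trans _ _ ((2 * g) ^+ 22)).
    by rewrite lerXn2r // nnegrE ?mulr_ge0 // ltW.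
  rewrite exprMn; apply: ler_wpM2l; first by rewrite exprn_ge0.
  by rewrite ler_weXn2l.
have c0 : 0 < 2 ^+ 66 * 6 ^+ 6 * g ^+ 70 :> K by rewrite !mulr_gt0 ?exprn_gt0.
rewrite div1r -invfM ler_pdivrMr //; apply: (le_trans Dl).
rewrite (_ : t * _ = 2 ^+ 44 * (2 ^+ 22 * g ^+ 70) * h); last by rewrite /h; ring.
by apply: ler_wpM2r => //; apply: ler_wpM2l; rewrite ?exprn_ge0.
Qed.

Theorem theorem3p3 (K : realType) :
  exists c : K, 0 < c /\
    forall (V : finType) (e : rel V) (A B : {set V}),
      simple_graph e ->
      bipartition e A B ->
      let m : K := #|edges e|%:R in
      let t : K := #|hexagons e|%:R in
      let L : K := #|A|%:R in
      let R : K := #|B|%:R in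
      let n : K := L + R in
      let dL : K := m / L in
      let dR : K := m / R in
      100 <= L -> L <= R ->
      L + R + (L * R) `^ (2 / 3) < m / (Num.ceil (log2 (L + R)))%:~R ^+ 10 ->
      dR ^+ 3 * dL ^+ 3 *
        Num.min 1 (Num.min (dR ^+ 3 / L) (dL ^+ 2 * dR ^+ 2 / L ^+ 2)) *
        (c * (1 / log2 n ^+ 70)) <= t.
Proof.
exists (2 ^+ 66 * 6 ^+ 6)^-1; split; first by rewrite invr_gt0 mulr_gt0 ?exprn_gt0.
move=> V e A B sg bp m t L R n dL dR L100 LR.
rewrite -/n; set g := log2 n => hyp.
have L0 : 0 < L by lra.
have R0 : 0 < R by lra.
have n0 : 0 < n by rewrite /n; lra.
have ln2 : 0 < ln 2 :> K by rewrite ln_gt0 // ltr1n.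
(* From [n >= 200 > 2 ^ 7]; hence the rounded logarithm [l] is at least 8 and
   [l < g + 1 <= 2 * g]. *)
have g7 : 7 < g.
  rewrite /g /log2 ltr_pdivlMr // mulr_natl -lnXn // ltr_ln ?posrE ?exprn_gt0 //.
  by rewrite (_ : 2 ^+ 7 = 128) /n; [lra | ring].
have [l lE] : exists l : nat, Num.ceil g = l%:Z.
  by exists `|Num.ceil g|%N; rewrite gez0_abs // ceil_ge0; lra.
have gl : g <= l%:R by have := ceil_ge g; rewrite lE.
have lg : l%:R < g + 1 by have := ceilB1_lt g; rewrite lE rmorphB /= -pmulrn; lra.
rewrite lE -pmulrn in hyp.
have l7 : (7 < l)%N by rewrite -(ltr_nat K); lra.
have l0 : 0 < (l%:R : K) by lra.
have l10 : 0 < (l%:R : K) ^+ 10 by rewrite exprn_gt0.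
set M := size_rel (fun x y => [&& e x y, x \in A & y \in B]).
have mM : m <= M%:R by rewrite ler_nat edges_le_size //; case: sg.
have pw0 : 0 <= (L * R) `^ (2 / 3) by apply: powR_ge0.
have hyp2 : (L + R + (L * R) `^ (2 / 3)) * l%:R ^+ 10 < M%:R.
  by apply: lt_le_trans mM; rewrite -ltr_pdivlMr.
have nl : (#|A| + #|B| <= 2 ^ l)%N.
  rewrite -(ler_nat K) natrD natrX -/L -/R -/n -ler_ln ?posrE ?exprn_gt0 //.
  by rewrite lnXn // -[leRHS]mulr_natl -ler_pdivrMr.
have MAB : (l ^ 10 * (#|A| + #|B|) <= M)%N.
  rewrite -(ler_nat K) natrM natrX natrD -/L -/R; apply/ltW/(le_lt_trans _ hyp2).
  by rewrite mulrC ler_pM2r // lerDl.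
have Ma : (l ^ 30 * (#|A| * #|B|) ^ 2 <= M ^ 3)%N.
  rewrite -(ler_nat K) natrM !natrX natrM -/L -/R.
  (* Cubing turns the exponent [2 / 3] into 2. *)
  have -> : l%:R ^+ 30 * (L * R) ^+ 2 = ((L * R) `^ (2 / 3) * l%:R ^+ 10) ^+ 3.
    rewrite [RHS]exprMn -exprM [LHS]mulrC; congr (_ * _).
    rewrite -[RHS]powR_mulrn // -powRrM -powR_mulrn ?mulr_ge0 ?ltW //.
    by congr (_ `^ _); field.
  rewrite lerXn2r ?nnegrE ?mulr_ge0 ?exprn_ge0 ?ler0n //.
  by apply/ltW/(le_lt_trans _ hyp2); rewrite ler_pM2r // lerDr /n; lra.
have A0 : (0 < #|A|)%N by rewrite -(ltr_nat K).
have AB : (#|A| <= #|B|)%N by rewrite -(ler_nat K).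
have m0 : 0 <= m by rewrite /m ler0n.
have t0 : 0 <= t by rewrite /t ler0n.
apply: (@hexagon_bound_arith _ m L R l%:R g t) => //; [lra | lra | lra |].
have := bipartite_hexagons sg bp l7 nl A0 AB MAB Ma; rewrite -/M.
case=> h; [left | right].
  apply: (@le_trans _ _ (M%:R ^+ 6)); first by rewrite lerXn2r ?nnegrE.
  by move: h; rewrite -(ler_nat K) !(natrM, natrX).
apply: (@le_trans _ _ (M%:R ^+ 9)); first by rewrite lerXn2r ?nnegrE.
by move: h; rewrite -(ler_nat K) !(natrM, natrX).
Qed.
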